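(* Let $n\ge 2$. The theory $T^n_{\mathrm{gcg}}$ is the model companion of $T^n_{\mathrm{cg}}$, and $T^n_{\mathrm{gcg}}$ is complete, simple and has IP.
   Context: Let $\mathcal L^n_{\mathrm{cg}}=\{R,C_1,\ldots,C_n\}$ with $R$ a binary predicate and $C_1,\ldots,C_n$ unary predicates. $T^n_{\mathrm{cg}}$ (the theory of $n$-partite graphs) is the $\mathcal L^n_{\mathrm{cg}}$-theory with axioms: (1) $\forall x\,\neg R(x,x)$; (2) $\forall x,y\,(R(x,y)\leftrightarrow R(y,x))$; (3) $\forall x\,\bigvee_{i=1}^n C_i(x)$; (4) $\forall x\,\bigwedge_{i=1}^n(C_i(x)\rightarrow\bigwedge_{j\ne i}\neg C_j(x))$; (5) $\forall x,y\,(R(x,y)\rightarrow\bigwedge_{i=1}^n(C_i(x)\rightarrow\neg C_i(y)))$. $T^n_{\mathrm{gcg}}$ (the theory of generic $n$-partite graphs) is the extension of $T^n_{\mathrm{cg}}$ by the following sentences (6), one for each $1\le k\le n$, each choice of nonnegative integers $m_1,\ldots,m_n$, and each map $\sigma:\bigcup_{i=1}^n(\{i\}\times\{1,\ldots,m_i\})\to\{0,1\}$: $$\forall\overline{x^1}\cdots\forall\overline{x^n}\Big(\bigwedge_{i=1}^n C_i(\overline{x^i})\rightarrow\exists y\ \bigwedge_{i\ne k}\bigwedge_{j=1}^{m_i}R^{\sigma(i,j)}(x^i_j,y)\wedge C_k(y)\Big),$$ where $\overline{x^i}=(x^i_1,\ldots,x^i_{m_i})$ ranges over tuples of pairwise distinct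 elements, $C_i(\overline{x^i})$ means $\bigwedge_j C_i(x^i_j)$, $R^0(x,y)$ is $\neg R(x,y)$ and $R^1(x,y)$ is $R(x,y)$. A theory $T^*$ is the model companion of a theory $T$ in the same language if every model of $T$ embeds in a model of $T^*$, every model of $T^*$ embeds in a model of $T$, and $T^*$ is model complete. A theory has IP if there are a formula $\phi(\overline x,\overline y)$ and an infinite set $A$ of tuples from a model such that for every finite $B\subseteq A$ and every $I\subseteq B$, $\exists\overline x\,(\bigwedge_{\overline a\in I}\phi(\overline x,\overline a)\wedge\bigwedge_{\overline a\in B\setminus I}\neg\phi(\overline x,\overline a))$ holds. A formula $\phi(\overline x,\overline y)$ has the tree property (with respect to $k$) if there is a tree of parameters $(\overline a_s\mid\emptyset\ne s\in\omega^{<\omega})$ such that $(\phi(\overline x,\overline a_{s^\frown i})\mid i<\omega)$ is $k$-inconsistent for every $s\in\omega^{<\omega}$ and $\{\phi(\overline x,\overline a_s)\mid\emptyset\ne s\subseteq\sigma\}$ is consistent for every $\sigma\in\omega^\omega$. A theory is simple if no formula has the tree property. *)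

(* Defs.v *)
From mathcomp Require Import all_boot.
From mathcomp Require Import boolp classical_sets cardinality.

Set Implicit Arguments.
Unset Strict Implicit.
Unset Printing Implicit Defensive.

Local Open Scope classical_set_scope.

Record language := Language {
  symbol : Type;
  arity : symbol -> nat
}.

(* [formula L n]: formulas whose free variables are among n variables, with
   well-scoped de Bruijn indices; in the body of a quantifier the bound
   variable is [ord0] and an outer variable i becomes [lift ord0 i].
   There being no function symbols, the terms are exactly the variables. *)
Inductive formula (L : language) : nat -> Type :=
| FFalse n : formula L n
| FEq n (i j : 'I_n) : formula L n
| FRel n (r : symbol L) (v : (arity r).-tuple 'I_n) : formula L n
| FAnd n (f g : formula L n) : formula L n
| FOr n (f g : formula L n) : formula L n
| FImp n (f g : formula L n) : formula L n
| FAll n (f : formula L n.+1) : formula L n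
| FEx n (f : formula L n.+1) : formula L n.

Arguments FFalse {L n}.
Arguments FEq {L n} i j.
Arguments FRel {L n} r v.
Arguments FAnd {L n} f g.
Arguments FOr {L n} f g.
Arguments FImp {L n} f g.
Arguments FAll {L n} f.
Arguments FEx {L n} f.

Definition FNot L n (f : formula L n) : formula L n := FImp f FFalse.
Definition FTrue L n : formula L n := FNot FFalse.
Definition FIff L n (f g : formula L n) : formula L n :=
  FAnd (FImp f g) (FImp g f).
Arguments FTrue {L n}.

Notation sentence L := (formula L 0).

Fixpoint universal_closure L n : formula L n -> sentence L :=
  match n with
  | 0 => fun f => f
  | n'.+1 => fun f => universal_closure (FAll f)
  end.

Record structure (L : language) := Structure {
  carrier :> Type;
  interp : forall r : symbol L, (arity r).-tuple carrier -> Prop;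
  carrier_nonempty : inhabited carrier
}.

Fixpoint sat L (M : structure L) n (f : formula L n) : n.-tuple M -> Prop :=
  match f in formula _ n return n.-tuple M -> Prop with
  | FFalse _ => fun _ => False
  | FEq _ i j => fun e => tnth e i = tnth e j
  | FRel _ r v => fun e => interp (map_tuple (tnth e) v)
  | FAnd _ f g => fun e => sat f e /\ sat g e
  | FOr _ f g => fun e => sat f e \/ sat g e
  | FImp _ f g => fun e => sat f e -> sat g e
  | FAll _ f => fun e => forall x : M, sat f (cons_tuple x e)
  | FEx _ f => fun e => exists x : M, sat f (cons_tuple x e)
  end.

Notation theory L := (set (formula L 0)).

Definition is_model L (T : theory L) (M : structure L) : Prop :=
  forall f, T f -> sat f [tuple of [::] : seq M].

Definition entails L (T : theory L) (f : sentence L) : Prop :=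
  forall M : structure L, is_model T M -> sat f [tuple of [::] : seq M].

Definition complete_theory L (T : theory L) : Prop :=
  (exists M : structure L, is_model T M) /\
  (forall f : sentence L, entails T f \/ entails T (FNot f)).

Definition embedding L (M N : structure L) (h : M -> N) : Prop :=
  injective h /\
  (forall (r : symbol L) (v : (arity r).-tuple M),
      interp v <-> interp (map_tuple h v)).

Definition elementary_embedding L (M N : structure L) (h : M -> N) : Prop :=
  forall n (f : formula L n) (e : n.-tuple M), sat f e <-> sat f (map_tuple h e).

Definition model_complete L (T : theory L) : Prop :=
  forall M N : structure L, is_model T M -> is_model T N ->
  forall h : M -> N, embedding h -> elementary_embedding h.

Definition models_embed_in_models L (T T' : theory L) : Prop :=
  forall M : structure L, is_model T M ->
  exists N : structure L, is_model T' N /\ exists h : M -> N, embedding h.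

Definition model_companion L (T' T : theory L) : Prop :=
  [/\ models_embed_in_models T T', models_embed_in_models T' T
    & model_complete T'].

(* A formula f(x, y) with |x| = p and |y| = q is an element of
   [formula L (p + q)], evaluated at the concatenation of the two tuples. *)

Definition has_IP L (T : theory L) : Prop :=
  exists (p q : nat) (f : formula L (p + q)) (M : structure L)
         (A : set (q.-tuple M)),
  [/\ is_model T M, infinite_set A
    & forall B I : set (q.-tuple M), finite_set B -> B `<=` A -> I `<=` B ->
      exists x : p.-tuple M,
        (forall a, I a -> sat f (cat_tuple x a)) /\
        (forall a, (B `\` I) a -> ~ sat f (cat_tuple x a))].

(* The set { f(x, a) | a in S } of formulas with parameters in [M] is
   consistent with the elementary diagram of [M]. *)
Definition consistent L (M : structure L) p q (f : formula L (p + q))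
    (S : set (q.-tuple M)) : Prop :=
  exists (N : structure L) (h : M -> N), elementary_embedding h /\
  exists x : p.-tuple N, forall a, S a -> sat f (cat_tuple x (map_tuple h a)).

(* k-inconsistency concerns sets of k distinct indices: the parameters
   themselves may repeat. *)
Definition k_inconsistent L (M : structure L) p q (f : formula L (p + q))
    (k : nat) (b : nat -> q.-tuple M) : Prop :=
  forall J : seq nat, uniq J -> size J = k ->
  ~ consistent f [set b i | i in [set` J]].

(* The tree of parameters is indexed by finite sequences; its value at the
   empty sequence plays no role. *)
Definition tree_property_wrt L (T : theory L) p q (f : formula L (p + q))
    (k : nat) : Prop :=
  exists (M : structure L) (a : seq nat -> q.-tuple M),
  [/\ is_model T M,
      forall s : seq nat, k_inconsistent f k (fun i => a (rcons s i))
    & forall t : nat -> nat, consistent f (range (fun m => a (mkseq t m.+1)))].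

Definition tree_property L (T : theory L) p q (f : formula L (p + q)) : Prop :=
  exists k : nat, tree_property_wrt T f k.

Definition simple_theory L (T : theory L) : Prop :=
  forall p q (f : formula L (p + q)), ~ tree_property T f.

Inductive cg_symbol (n : nat) := Edge | Colour of 'I_n.
Arguments Edge {n}.

Definition cg_language (n : nat) : language :=
  Language (fun r : cg_symbol n => if r is Colour _ then 1 else 2).

Definition R_ n k (x y : 'I_k) : formula (cg_language n) k :=
  @FRel (cg_language n) k Edge [tuple x; y].

Definition C_ n k (i : 'I_n) (x : 'I_k) : formula (cg_language n) k :=
  @FRel (cg_language n) k (Colour i) [tuple x].

Definition Rsign n k (b : bool) (x y : 'I_k) : formula (cg_language n) k :=
  if b then R_ n x y else FNot (R_ n x y).

Definition ax_irreflexive n : sentence (cg_language n) :=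
  FAll (FNot (R_ n ord0 ord0)).

Definition ax_symmetric n : sentence (cg_language n) :=
  let x : 'I_2 := ord_max in let y : 'I_2 := ord0 in
  FAll (FAll (FIff (R_ n x y) (R_ n y x))).

Definition ax_cover n : sentence (cg_language n) :=
  FAll (\big[FOr/FFalse]_(i < n) C_ i ord0).

Definition ax_disjoint n : sentence (cg_language n) :=
  FAll (\big[FAnd/FTrue]_(i < n)
          FImp (C_ i ord0)
               (\big[FAnd/FTrue]_(j < n | j != i) FNot (C_ j ord0))).

Definition ax_partite n : sentence (cg_language n) :=
  let x : 'I_2 := ord_max in let y : 'I_2 := ord0 in
  FAll (FAll (FImp (R_ n x y)
    (\big[FAnd/FTrue]_(i < n) FImp (C_ i x) (FNot (C_ i y))))).

Definition Tcg n : theory (cg_language n) :=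
  [set ax_irreflexive n; ax_symmetric n; ax_cover n; ax_disjoint n;
       ax_partite n].
Arguments Tcg n : clear implicits.

(* The variables x^i_j with j < m i: the pairs (i, j) form a finite type,
   numbered through its canonical enumeration. *)
Notation var_pairs m := {i : _ & 'I_(m i)}.

Definition var_pair n (m : 'I_n -> nat) (i : 'I_n) (j : 'I_(m i)) :
  var_pairs m := Tagged (fun i => 'I_(m i)) j.

Definition var_x n (m : 'I_n -> nat) (i : 'I_n) (j : 'I_(m i)) :
  'I_#|{: var_pairs m}| := enum_rank (var_pair j).

Definition ext_hypothesis n (m : 'I_n -> nat) :
    formula (cg_language n) #|{: var_pairs m}| :=
  \big[FAnd/FTrue]_(i < n)
    FAnd (\big[FAnd/FTrue]_(j < m i) C_ i (var_x j))
         (\big[FAnd/FTrue]_(j < m i)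
            \big[FAnd/FTrue]_(j' < m i | j' != j)
               FNot (FEq (var_x j) (var_x j'))).

Definition ext_conclusion n (k : 'I_n) (m : 'I_n -> nat)
    (s : var_pairs m -> bool) : formula (cg_language n) #|{: var_pairs m}| :=
  FEx (FAnd
    (\big[FAnd/FTrue]_(i < n | i != k)
       \big[FAnd/FTrue]_(j < m i)
          Rsign n (s (var_pair j)) (lift ord0 (var_x j)) ord0)
    (C_ k ord0)).

Definition ax_extension n (k : 'I_n) (m : 'I_n -> nat)
    (s : var_pairs m -> bool) : sentence (cg_language n) :=
  universal_closure (FImp (ext_hypothesis m) (ext_conclusion k s)).

Definition Tgcg n : theory (cg_language n) :=
  Tcg n `|` [set f | exists (k : 'I_n) (m : 'I_n -> nat)
                            (s : var_pairs m -> bool), f = ax_extension k s].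
Arguments Tgcg n : clear implicits.

(* Main.v *)
Require Import Defs.
From mathcomp Require Import all_boot.
From mathcomp Require Import boolp classical_sets cardinality.

Set Implicit Arguments.
Unset Strict Implicit.
Unset Printing Implicit Defensive.

Local Open Scope classical_set_scope.

(** Everything rests on one extension property.  In a model of [Tgcg n] the
    colour classes are infinite, so a vertex prescribed by the axioms of
    extension can moreover be chosen outside any given finite set
    ([fresh_witness]).  Hence, when a finite family [x] of a model has the same
    quantifier-free type as a family [z] of another one, every vertex [b]
    there has a counterpart here, and the formulas satisfied by a tuple depend
    only on its quantifier-free type ([sat_same_qf]).  This back-and-forth
    gives model completeness at once, and completeness by taking the empty
    tuple.  That [Tgcg n] is consistent and that every [n]-partite graph embeds
    in one of its models is seen by freely adding, to the given graph, a vertex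
    for every prescription ([tower]).  The edge relation has IP because every
    subset of a finite set of vertices of one colour is cut out by the
    neighbourhood of a vertex of another colour.

    For simplicity, let [f(x, y)] have the tree property.  Call coherent a
    set of tuples in which a vertex never occurs at two places that one of
    the tuples tells apart.  Below any node, and for any finite set [F] of
    vertices, arbitrarily many children can be selected whose parameters have
    the same quantifier-free type over [F] and are coherent
    ([thin_children]).  If [b] satisfies [f(x, a)] for a selected child [a] and
    meets [a] only inside [F], then the requirements imposed on [b] by all
    selected children are compatible, and the extension property produces one
    tuple that satisfies all the corresponding formulas ([views_extends]).
    This contradicts the [k]-inconsistency of the children.  So every
    realisation of [f(x, a)] shares with [a] a vertex outside [F]
    ([new_element]).  Descend in the tree through such children, [F] being the set of all parameters met before.  A
    realisation of the whole branch then has a coordinate among the new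
    parameters of each level; the sets of new parameters being pairwise
    disjoint, it needs infinitely many coordinates ([Tgcg_simple]). *)

(** * Satisfaction of the axioms *)

Section Satisfaction.
Variables (L : language) (M : structure L).

Lemma sat_bigAnd k (I : finType) (P : pred I) (F : I -> formula L k)
    (e : k.-tuple M) :
  sat (\big[FAnd/FTrue]_(i | P i) F i) e <-> forall i, P i -> sat (F i) e.
Proof.
suff H r : sat (\big[FAnd/FTrue]_(i <- r | P i) F i) e <->
    forall i, i \in r -> P i -> sat (F i) e.
  by rewrite H; split=> h i; [apply: h; exact: mem_index_enum | move=> _; exact: h].
elim: r => [|i r IHr]; first by rewrite big_nil /=; split.
rewrite big_cons; split.
  case: ifP => Pi; last first.
    by move/IHr => h j; rewrite inE => /orP[/eqP->|/h//]; rewrite Pi.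
  by move=> /= [hi /IHr h] j; rewrite inE => /orP[/eqP->//|/h].
move=> h; have hr : sat (\big[FAnd/FTrue]_(i <- r | P i) F i) e.
  by apply/IHr => j jr; apply: h; rewrite inE jr orbT.
by case: ifP => Pi //=; split=> //; apply: h => //; rewrite mem_head.
Qed.

Lemma sat_bigOr k (I : finType) (F : I -> formula L k) (e : k.-tuple M) :
  sat (\big[FOr/FFalse]_i F i) e <-> exists i, sat (F i) e.
Proof.
suff H r : sat (\big[FOr/FFalse]_(i <- r) F i) e <->
    exists i, i \in r /\ sat (F i) e.
  by rewrite H; split=> -[i] => [[_ h]|h]; exists i => //; rewrite mem_index_enum.
elim: r => [|i r IHr]; first by rewrite big_nil /=; split=> // -[i []].
rewrite big_cons /=; split.
  case=> [h|/IHr[j [jr h]]]; first by exists i; rewrite mem_head.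
  by exists j; rewrite inE jr orbT.
case=> j []; rewrite inE => /orP[/eqP->|jr] h; first by left.
by right; apply/IHr; exists j.
Qed.

Lemma sat_universal_closure k (f : formula L k) :
  sat (universal_closure f) [tuple of [::] : seq M] <->
  forall e : k.-tuple M, sat f e.
Proof.
elim: k f => [|k IHk] f /=.
  by split=> [h e|]; [rewrite (tuple0 e) | exact].
rewrite IHk /=; split=> h e; last by move=> x; apply: h.
by case/tupleP: e => x e; apply: h.
Qed.

End Satisfaction.

Lemma tnth_cons0 (T : Type) k (x : T) (e : k.-tuple T) :
  tnth (cons_tuple x e) ord0 = x.
Proof. by []. Qed.

Lemma tnth_consS (T : Type) k (x : T) (e : k.-tuple T) i :
  tnth (cons_tuple x e) (lift ord0 i) = tnth e i.
Proof. by rewrite (_ : cons_tuple x e = [tuple of x :: e]) ?tnthS //; apply: val_inj. Qed.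

Section Vocabulary.
Variables (n : nat) (M : structure (cg_language n)).

Definition adj (x y : M) : Prop := @interp _ M Edge [tuple x; y].

Definition colour (c : 'I_n) (x : M) : Prop := @interp _ M (Colour c) [tuple x].

Record partite_graph : Prop := PartiteGraph {
  adj_irrefl : forall x, ~ adj x x;
  adj_sym : forall x y, adj x y -> adj y x;
  colour_cover : forall x, exists c, colour c x;
  colour_inj : forall x c d, colour c x -> colour d x -> c = d;
  adj_colour : forall x y c, adj x y -> colour c x -> ~ colour c y
}.

(** The extension axioms over arbitrary finite families of vertices: instead
    of being distinct, the vertices may repeat as long as the prescription [P]
    respects the repetitions, and they need not be sorted by colour. *)
Definition generic : Prop :=
  forall (k : 'I_n) (I : finType) (x : I -> M) (P : pred I),
  (forall i j, x i = x j -> P i = P j) ->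
  exists y, colour k y /\ forall i, ~ colour k (x i) -> (adj (x i) y <-> P i).

Lemma sat_adj k (e : k.-tuple M) i j :
  sat (R_ n i j) e <-> adj (tnth e i) (tnth e j).
Proof.
rewrite /adj /= (_ : map_tuple _ _ = [tuple tnth e i; tnth e j]) //.
exact: val_inj.
Qed.

Lemma sat_colour k (e : k.-tuple M) c i :
  sat (C_ c i) e <-> colour c (tnth e i).
Proof.
rewrite /colour /= (_ : map_tuple _ _ = [tuple tnth e i]) //.
exact: val_inj.
Qed.

Lemma Tcg_modelP : is_model (Tcg n) M <-> partite_graph.
Proof.
have e1 c x : sat (C_ c ord0) (cons_tuple x [tuple]) <-> colour c x.
  exact: (sat_colour (cons_tuple x [tuple])).
pose e x y : 2.-tuple M := cons_tuple y (cons_tuple x [tuple]).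
have exy x y : sat (R_ n ord_max ord0) (e x y) <-> adj x y.
  exact: (sat_adj (e x y)).
have eyx x y : sat (R_ n ord0 ord_max) (e x y) <-> adj y x.
  exact: (sat_adj (e x y)).
have ex c x y : sat (C_ c ord_max) (e x y) <-> colour c x.
  exact: (sat_colour (e x y)).
have ey c x y : sat (C_ c ord0) (e x y) <-> colour c y.
  exact: (sat_colour (e x y)).
have exx x : sat (R_ n ord0 ord0) (cons_tuple x [tuple]) <-> adj x x.
  exact: (sat_adj (cons_tuple x [tuple])).
split=> [h|[irr sym cov inj par]].
  split.
  - move=> x /exx xx.
    exact: (h _ (or_introl (or_introl (or_introl (or_introl erefl)))) x xx).
  - move=> x y /exy xy; apply/eyx.
    exact: (h _ (or_introl (or_introl (or_introl (or_intror erefl)))) x y).1.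
  - move=> x.
    have /sat_bigOr[c /e1] := h _ (or_introl (or_introl (or_intror erefl))) x.
    by exists c.
  - move=> x c d /e1 cx /e1 dx; apply: contrapT => cd.
    have /sat_bigAnd /(_ c isT cx) := h _ (or_introl (or_intror erefl)) x.
    by move=> /sat_bigAnd /(_ d); apply=> //; apply/eqP => dc; apply: cd.
  - move=> x y c /exy xy /(ex c x y) cx /(ey c x y) cy.
    by have /sat_bigAnd /(_ c isT cx) := h _ (or_intror erefl) x y xy; apply.
move=> f [[[[]|]|]|] ->.
- by move=> x /exx /irr.
- by move=> x y; split=> [/exy /sym /eyx|/eyx /sym /exy].
- by move=> x; apply/sat_bigOr; have [c cx] := cov x; exists c; apply/e1.
- move=> x; apply/sat_bigAnd => c _ /e1 cx.
  apply/sat_bigAnd => d /eqP dc /e1 dx; apply: dc; exact: inj dx cx.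
- move=> x y /exy xy; apply/sat_bigAnd => c _ /ex cx /ey.
  exact: par xy cx.
Qed.

Lemma sat_ext_hypothesis (m : 'I_n -> nat)
    (e : #|{: var_pairs m}|.-tuple M) :
  sat (ext_hypothesis m) e <-> forall c,
    (forall j : 'I_(m c), colour c (tnth e (var_x j))) /\
    (forall j j' : 'I_(m c), tnth e (var_x j) = tnth e (var_x j') -> j = j').
Proof.
rewrite /ext_hypothesis sat_bigAnd; split=> h c.
  have [/sat_bigAnd hc /sat_bigAnd hd] := h c isT; split=> [j|j j' jj'].
    exact/sat_colour/hc.
  apply: contrapT => ne; have /sat_bigAnd /(_ j') := hd j isT.
  by apply=> //; apply/eqP => eq; apply: ne.
move=> _; have [hc hd] := h c; split; apply/sat_bigAnd => j _.
  exact/sat_colour.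
by apply/sat_bigAnd => j' /eqP ne /= /hd jj'; apply: ne.
Qed.

Lemma sat_ext_conclusion k (m : 'I_n -> nat) (s : var_pairs m -> bool)
    (e : #|{: var_pairs m}|.-tuple M) :
  sat (ext_conclusion k s) e <-> exists y, colour k y /\
    forall c (j : 'I_(m c)), c != k ->
      (adj (tnth e (var_x j)) y <-> s (var_pair j)).
Proof.
have sgn b y i : sat (Rsign n b (lift ord0 i) ord0) (cons_tuple y e) <->
    (adj (tnth e i) y <-> b).
  have := sat_adj (cons_tuple y e) (lift ord0 i) ord0.
  rewrite tnth_consS tnth_cons0 => <-.
  case: b => /=; first by split=> [r|[_]]; [split | apply].
  by split=> [nr|[nr _]]; [split=> // /nr | move=> /nr].
split=> [[y [/sat_bigAnd h /sat_colour ky]]|[y [ky h]]]; exists y.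
  split=> // c j ck; apply/sgn.
  by have /sat_bigAnd := h c ck; apply.
split; last exact/sat_colour.
apply/sat_bigAnd => c ck; apply/sat_bigAnd => j _; apply/sgn.
exact: h.
Qed.

Lemma generic_sat k (m : 'I_n -> nat) (s : var_pairs m -> bool) :
  partite_graph -> generic ->
  sat (ax_extension k s) [tuple of [::] : seq M].
Proof.
move=> MG MX; apply/sat_universal_closure => e /sat_ext_hypothesis he.
apply/sat_ext_conclusion.
have [|y [ky hy]] :=
    MX k _ (fun v : var_pairs m => tnth e (enum_rank v)) s.
  case=> [c j] [d j'] eq.
  have cd : c = d.
    apply: (colour_inj MG ((he c).1 j)).
    by rewrite /var_x [X in colour _ X]eq; exact: (he d).1.
  by case: d / cd j' eq => j' /(he c).2 ->.
exists y; split=> // c j ck; apply: hy => kx.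
by move/eqP: ck; apply; exact: (colour_inj MG ((he c).1 j)).
Qed.

Lemma sat_generic :
  partite_graph ->
  (forall k (m : 'I_n -> nat) (s : var_pairs m -> bool),
     sat (ax_extension k s) [tuple of [::] : seq M]) ->
  generic.
Proof.
move=> MG h k I x P xP.
(* The axioms speak of distinct vertices sorted by colour: keep one index for
   each vertex, and number the indices kept in each colour. *)
pose rep i := odflt i [pick j | `[< x j = x i >]].
have xrep i : x (rep i) = x i.
  by rewrite /rep; case: pickP => //= j /asboolP.
have repE i j : x i = x j -> rep i = rep j.
  move=> ij; rewrite /rep ij; case: pickP => //= /(_ j).
  by rewrite asboolT.
pose A c := [set i | (i == rep i) && `[< colour c (x i) >]]%SET.
pose m c := #|A c|.
pose vtx (v : var_pairs m) : I := enum_val (tagged v).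
pose e := [tuple x (vtx (enum_val t)) | t < #|{: var_pairs m}|].
have eE c (j : 'I_(m c)) : tnth e (var_x j) = x (enum_val j).
  by rewrite tnth_mktuple /var_x enum_rankK.
have colA c (j : 'I_(m c)) : colour c (x (enum_val j)).
  by have := enum_valP j; rewrite inE => /andP[_ /asboolP].
have /sat_universal_closure /(_ e) := h k m (fun v => P (vtx v)).
case/(_ _)/sat_ext_conclusion.
  apply/sat_ext_hypothesis => c; split=> [j|j j']; rewrite !eE //.
  have := enum_valP j; have := enum_valP j'; rewrite !inE.
  move=> /andP[/eqP rj' _] /andP[/eqP rj _] /repE.
  by rewrite -rj -rj' => /enum_val_inj.
move=> y [ky hy]; exists y; split=> // i kxi.
have [c ci] := colour_cover MG (x i).
have ck : c != k by apply/eqP => ck; apply: kxi; rewrite -ck.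
have iA : rep i \in A c.
  by rewrite inE (repE _ _ (xrep i)) eqxx xrep asboolT.
rewrite -(xrep i) -(xP _ _ (xrep i)).
have := hy c (enum_rank_in iA (rep i)) ck.
by rewrite eE /vtx /= enum_rankK_in.
Qed.

End Vocabulary.

Lemma Tgcg_modelP n (M : structure (cg_language n)) :
  is_model (Tgcg n) M <-> partite_graph M /\ generic M.
Proof.
split=> [h|[MG MX] f [fT|[k [m [s ->]]]]].
- have MG : partite_graph M by apply/Tcg_modelP => f fT; apply: h; left.
  split=> //; apply: sat_generic => // k m s.
  by apply: h; right; exists k, m, s.
- exact: (Tcg_modelP M).2 MG f fT.
- exact: generic_sat.
Qed.

(** * Infinite colour classes and fresh witnesses *)

Section FreshWitness.
Variables (n : nat) (M : structure (cg_language n)).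
Hypotheses (n_gt1 : 2 <= n) (MG : partite_graph M) (MX : generic M).

Lemma other_colour (k : 'I_n) : exists l : 'I_n, l != k.
Proof.
case: n n_gt1 k => [|[|m]] // _ k.
case: (eqVneq k ord0) => [->|kn]; last by exists ord0; rewrite eq_sym.
by exists ord_max.
Qed.

(** Distinct [v i] allow the edges to them to be prescribed independently: a
    vertex that disagrees with [x i] about [v i], for every [i], is none of the
    [x i]. *)
Lemma diagonal (k l : 'I_n) r (v : 'I_r -> M) (x : 'I_r -> M) : l != k ->
  injective v -> (forall i, colour l (v i)) ->
  exists y, colour k y /\ forall i, y <> x i.
Proof.
move=> lk vinj vl.
have [|y [ky hy]] := MX k (x := v) (P := fun i => ~~ `[< adj (v i) (x i) >]).
  by move=> i j /vinj ->.
exists y; split=> // i yx.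
have vk : ~ colour k (v i).
  by move/(colour_inj MG (vl i)) => lk'; rewrite lk' eqxx in lk.
have := hy i vk; rewrite -yx; case: asboolP => //= a.
  by case=> /(_ a).
by case=> _ /(_ isT).
Qed.

Lemma extend_injection T r (w : 'I_r -> T) (y : T) :
  injective w -> (forall i, y <> w i) ->
  injective (fun i : 'I_r.+1 => oapp w y (unlift ord0 i)).
Proof.
move=> winj yw i j; case: unliftP => [i'|] ->; case: unliftP => [j'|] -> //=.
- by move/winj ->.
- by move=> e; case: (yw i').
- by move=> e; case: (yw j').
Qed.

(** By induction on [r] for all colours at once: [r] vertices of another colour
    are what the diagonal argument needs to leave [r] vertices of colour [k]. *)
Lemma colour_infinite r (k : 'I_n) :
  exists2 w : 'I_r -> M, injective w & forall i, colour k (w i).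
Proof.
elim: r k => [|r IHr] k.
  have w0 : 'I_0 -> M by case.
  by exists w0; case.
have [w winj wk] := IHr k; have [l lk] := other_colour k.
have [v vinj vl] := IHr l.
have [y [ky yw]] := diagonal w lk vinj vl.
exists (fun i => oapp w y (unlift ord0 i)); first exact: extend_injection.
by move=> i; case: unliftP => [j|] _ /=.
Qed.

Lemma colour_avoid (k : 'I_n) (I : finType) (x : I -> M) :
  exists y, colour k y /\ forall i, y <> x i.
Proof.
have [l lk] := other_colour k; have [v vinj vl] := colour_infinite #|I| l.
have [y [ky yx]] := diagonal (x \o enum_val) lk vinj vl.
by exists y; split=> // i; have := yx (enum_rank i); rewrite /= enum_rankK.
Qed.

Lemma colour_infinite_avoid r (k : 'I_n) (I : finType) (x : I -> M) :
  exists w : 'I_r -> M,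
  [/\ injective w, forall i, colour k (w i) & forall i j, w i <> x j].
Proof.
elim: r => [|r [w [winj wk wx]]].
  have [w winj wk] := colour_infinite 0 k.
  by exists w; split=> // -[].
have [y [ky yw]] :=
  colour_avoid k (fun i : 'I_r + I => match i with inl i => w i | inr i => x i end).
exists (fun i => oapp w y (unlift ord0 i)); split.
- by apply: extend_injection => // i; exact: (yw (inl i)).
- by move=> i; case: unliftP => [j|] _ /=.
- by move=> i j; case: unliftP => [i'|] _ //=; exact: (yw (inr j)).
Qed.

(** To keep [y] away from [x i], add to the prescription a vertex [w i] outside
    the family, and ask that [y] and [x i] disagree about [w i]. *)
Lemma fresh_witness (k : 'I_n) (I : finType) (x : I -> M) (P : pred I) :
  (forall i j, x i = x j -> P i = P j) ->
  exists y, [/\ colour k y, forall i, y <> x i &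
                forall i, ~ colour k (x i) -> (adj (x i) y <-> P i)].
Proof.
move=> xP; have [l lk] := other_colour k.
have [w [winj wl wx]] := colour_infinite_avoid #|I| l x.
pose x' (i : I + I) := match i with inl i => x i | inr i => w (enum_rank i) end.
pose P' (i : I + I) :=
  match i with inl i => P i | inr i => ~~ `[< adj (w (enum_rank i)) (x i) >] end.
have [|y [ky hy]] := MX k (x := x') (P := P').
  case=> i [] j /=.
  - exact: xP.
  - by move=> e; case: (wx (enum_rank j) i).
  - by move=> e; case: (wx (enum_rank i) j).
  - by move/winj/enum_rank_inj ->.
exists y; split=> // i; last exact: (hy (inl i)).
move=> yx; have wk : ~ colour k (w (enum_rank i)).
  by move/(colour_inj MG (wl _)) => lk'; rewrite lk' eqxx in lk.
have /= := hy (inr i) wk; rewrite -yx; case: asboolP => //= a.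
  by case=> /(_ a).
by case=> _ /(_ isT).
Qed.

End FreshWitness.

(** * Quantifier-free types and back-and-forth *)

Section QfType.
Variable n : nat.
Implicit Types M N : structure (cg_language n).

(** Equality of the quantifier-free types of two families; there being only
    one binary and several unary relations, atomic formulas in two variables
    suffice. *)
Record same_qf (I : Type) M N (x : I -> M) (z : I -> N) : Prop := SameQf {
  qf_eq : forall i j, x i = x j <-> z i = z j;
  qf_adj : forall i j, adj (x i) (x j) <-> adj (z i) (z j);
  qf_colour : forall c i, colour c (x i) <-> colour c (z i)
}.

Lemma same_qf_reindex (I J : Type) (h : J -> I) M N (x : I -> M) (z : I -> N) :
  same_qf x z -> same_qf (x \o h) (z \o h).
Proof. by case=> e a c; split=> * /=. Qed.

Lemma same_qf_ext (I : Type) M N (x x' : I -> M) (z z' : I -> N) :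
  x =1 x' -> z =1 z' -> same_qf x z -> same_qf x' z'.
Proof. by move=> /funext <- /funext <-. Qed.

Lemma embedding_adj M N (h : M -> N) x y :
  embedding h -> adj (h x) (h y) <-> adj x y.
Proof.
move=> [_ hr]; rewrite /adj (hr Edge) (_ : map_tuple h _ = [tuple h x; h y]) //.
exact: val_inj.
Qed.

Lemma embedding_colour M N (h : M -> N) c x :
  embedding h -> colour c (h x) <-> colour c x.
Proof.
move=> [_ hr]; rewrite /colour (hr (Colour c)) (_ : map_tuple h _ = [tuple h x]) //.
exact: val_inj.
Qed.

Lemma embeddingP M N (h : M -> N) : injective h ->
  (forall x y, adj (h x) (h y) <-> adj x y) ->
  (forall c x, colour c (h x) <-> colour c x) -> embedding h.
Proof.
move=> hinj ha hc; split=> // -[|c] v.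
  case/tupleP: v => x v; case/tupleP: v => y v; rewrite [v]tuple0 {v}.
  rewrite (_ : [tuple of _] = [tuple x; y]); last exact: val_inj.
  rewrite (_ : map_tuple h _ = [tuple h x; h y]); last exact: val_inj.
  by symmetry; exact: ha.
case/tupleP: v => x v; rewrite [v]tuple0 {v}.
rewrite (_ : [tuple of _] = [tuple x]); last exact: val_inj.
rewrite (_ : map_tuple h _ = [tuple h x]); last exact: val_inj.
by symmetry; exact: hc.
Qed.

Lemma embedding_same_qf (I : Type) M N (h : M -> N) (x : I -> M) :
  embedding h -> same_qf x (h \o x).
Proof.
move=> hE; split=> *.
- by split=> [/= ->|/(proj1 hE)].
- by rewrite /= embedding_adj.
- by rewrite /= embedding_colour.
Qed.

Lemma same_qf_trans (I : Type) M1 M2 M3 (x : I -> M1) (y : I -> M2) (z : I -> M3) :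
  same_qf x y -> same_qf y z -> same_qf x z.
Proof.
case=> e a c [e' a' c']; split=> *.
- exact: iff_trans (e _ _) (e' _ _).
- exact: iff_trans (a _ _) (a' _ _).
- exact: iff_trans (c _ _) (c' _ _).
Qed.

Lemma same_qf_sym (I : Type) M N (x : I -> M) (z : I -> N) :
  same_qf x z -> same_qf z x.
Proof. by case=> e a c; split=> *; apply: iff_sym. Qed.

(** The [v u] are copies of [z] which may overlap, but only at places that [z]
    identifies.  So a requirement on a vertex which is stated in terms of [z]
    can be imposed over all the copies simultaneously.  A single copy serves
    for back-and-forth, and many copies for the amalgamation that refutes
    [k]-inconsistency. *)
Definition views (U I : Type) M N (v : U -> I -> M) (z : I -> N) : Prop :=
  (forall u, same_qf (v u) z) /\
  forall u w i j, v u i = v w j -> z i = z j.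

Lemma views_one (I : Type) M N (x : I -> M) (z : I -> N) :
  same_qf x z -> views (fun _ : unit => x) z.
Proof. by move=> xz; split=> // _ _ i j /(qf_eq xz). Qed.

(** The same [a] must play the role of [b] over all copies.  If [b] occurs in
    [z] at a place where the copies agree, their common value is forced;
    otherwise [b] is new, and [a] is chosen fresh with the edges of [b], a
    consistent prescription by the overlap condition on views. *)
Lemma views_extend (U : finType) (u0 : U) (I : finType) M N
    (v : U -> I -> M) (z : I -> N) (b : N) :
  2 <= n -> partite_graph M -> generic M -> partite_graph N -> views v z ->
  (exists i, b = z i /\ forall u w, v u i = v w i) \/ (forall i, b <> z i) ->
  exists a, views (fun u => oapp (v u) a) (oapp z b).
Proof.
move=> n_gt1 MG MX NG [vz vc].
case=> [[i [-> vi]]|bz].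
  exists (v u0 i); split=> [u|u w].
    apply: same_qf_ext (same_qf_reindex (odflt i) (vz u)) => -[j|] //=.
  case=> [j|] [k|] //=; [exact: vc | exact: vc | exact: vc ].
pose x (t : U * I) := v t.1 t.2.
have [c bc] := colour_cover NG b.
have [|a [ac ax hax]] := fresh_witness n_gt1 MG MX c (x := x)
    (P := fun t => `[< adj (z t.2) b >]).
  by move=> [u i] [w j] /vc /= ->.
have cE d : colour d a <-> colour d b.
  by split=> [/(colour_inj MG ac) <-|/(colour_inj NG bc) <-].
have aE u i : adj (v u i) a <-> adj (z i) b.
  have [ci|/(hax (u, i)) ->] := pselect (colour c (x (u, i))).
    have zi : colour c (z i) by apply/(qf_colour (vz u)).
    split=> h; first by case: (adj_colour MG h ci).
    by case: (adj_colour NG h zi).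
  by split=> [/asboolP|] // h; apply/asboolP.
have symM p q : adj (M := M) p q <-> adj q p by split; exact: adj_sym.
have symN p q : adj (M := N) p q <-> adj q p by split; exact: adj_sym.
exists a; split=> [u|u w]; first split.
- case=> [i|] [j|] //=; first exact: qf_eq.
    by split=> [e|/esym/bz//]; case: (ax (u, i)).
  by split=> [/(ax (u, j))|/bz].
- case=> [i|] [j|] //=; [exact: qf_adj|by rewrite symM symN|].
  by split=> /adj_irrefl; [case/(_ MG)|case/(_ NG)].
- by move=> d [i|] /=; [exact: qf_colour | exact: cE].
- case=> [i|] [j|] //=; first exact: vc.
    by move=> e; case: (ax (u, i)).
  by move=> e; case: (ax (w, j)).
Qed.

Definition case_sum (A B T : Type) (f : A -> T) (g : B -> T) (i : A + B) : T :=
  match i with inl a => f a | inr b => g b end.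

(** Iterating the one-point extension is possible because a value already
    chosen is shared by all copies: if [b] repeats it, the first case
    applies. *)
Lemma views_extends (U : finType) (u0 : U) (I : finType) p M N
    (v : U -> I -> M) (z : I -> N) (b : 'I_p -> N) :
  2 <= n -> partite_graph M -> generic M -> partite_graph N -> views v z ->
  (forall j, (exists i, b j = z i /\ forall u w, v u i = v w i) \/
             (forall i, b j <> z i)) ->
  exists a : 'I_p -> M, views (fun u => case_sum a (v u)) (case_sum b z).
Proof.
move=> n_gt1 MG MX NG vz; elim: p b => [|p IHp] b hb.
  have a0 : 'I_0 -> M by case.
  exists a0; split=> [u|u w]; last by case=> [[]//|i] [[]//|j] /(proj2 vz).
  split=> [|| c]; repeat case=> [[]//|?] /=.
  - exact: qf_eq (vz.1 u) _ _.
  - exact: qf_adj (vz.1 u) _ _.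
  - exact: qf_colour (vz.1 u) _ _.
have [a haz] := IHp (b \o lift ord0) (fun j => hb (lift ord0 j)).
have [|a0 [qf coh]] := views_extend u0 n_gt1 MG MX NG (b := b ord0) haz.
  have [[i [-> vi]]|bz] := hb ord0; first by left; exists (inr i).
  (* The new entry may repeat one of the entries already copied. *)
have [[j bj]|bb] := pselect (exists j, b ord0 = b (lift ord0 j)).
    by left; exists (inl j).
  by right; case=> [j bj|//]; apply: bb; exists j.
pose re (i : 'I_p.+1 + I) : option ('I_p + I) :=
  match i with inl i => omap inl (unlift ord0 i) | inr i => Some (inr i) end.
have reE M' (f : 'I_p -> M') g c :
    oapp (case_sum f g) c \o re =
    case_sum (fun i => oapp f c (unlift ord0 i)) g.
  by apply/funext => -[i|i] //=; case: unlift.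
have bE : (fun i => oapp (b \o lift ord0) (b ord0) (unlift ord0 i)) = b.
  by apply/funext => i; case: unliftP => [j|] ->.
exists (fun i => oapp a a0 (unlift ord0 i)); split=> [u|u w i j].
  by have := same_qf_reindex re (qf u); rewrite !reE bE.
by have := coh u w (re i) (re j); rewrite -!/((_ \o re) _) !reE bE.
Qed.

(** Back-and-forth: extending the families by one vertex on either side handles
    the quantifiers. *)
Lemma sat_same_qf M N : 2 <= n ->
  partite_graph M -> generic M -> partite_graph N -> generic N ->
  forall k (f : formula (cg_language n) k) (e : k.-tuple M) (e' : k.-tuple N),
  same_qf (tnth e) (tnth e') -> (sat f e <-> sat f e').
Proof.
move=> n_gt1 MG MX NG NX.
have tnth_consE (T : Type) k (y : T) (e : k.-tuple T) :
    oapp (tnth e) y \o unlift ord0 =1 tnth (cons_tuple y e).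
  by move=> i /=; case: unliftP => [j|] ->; rewrite ?tnth_consS.
have forth k (e : k.-tuple M) (e' : k.-tuple N) b : same_qf (tnth e) (tnth e') ->
    exists a, same_qf (tnth (cons_tuple a e)) (tnth (cons_tuple b e')).
  move=> ee'; have [|a [av _]] := views_extend tt n_gt1 MG MX NG (b := b) (views_one ee').
    have [[i bi]|bn] := pselect (exists i, b = tnth e' i).
      by left; exists i.
    by right=> i bi; apply: bn; exists i.
  exists a; exact: same_qf_ext (same_qf_reindex (unlift ord0) (av tt)).
have back k (e : k.-tuple M) (e' : k.-tuple N) a : same_qf (tnth e) (tnth e') ->
    exists b, same_qf (tnth (cons_tuple a e)) (tnth (cons_tuple b e')).
  move=> /same_qf_sym ee'.
  have [|b [bv _]] := views_extend tt n_gt1 NG NX MG (b := a) (views_one ee').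
    have [[i ai]|an] := pselect (exists i, a = tnth e i).
      by left; exists i.
    by right=> i ai; apply: an; exists i.
  exists b; apply: same_qf_sym.
  exact: same_qf_ext (same_qf_reindex (unlift ord0) (bv tt)).
move=> k f; elim: f => {k} [k|k i j|k r v|k f IHf g IHg|k f IHf g IHg|k f IHf g IHg
  |k f IHf|k f IHf] e e' ee' /=.
- by [].
- exact: qf_eq.
- case: r v => [|c] v.
    case/tupleP: v => x v; case/tupleP: v => y v; rewrite [v]tuple0 {v}.
    rewrite (_ : [tuple of _] = [tuple x; y]); last exact: val_inj.
    apply: iff_trans (sat_adj e x y) (iff_trans _ (iff_sym (sat_adj e' x y))).
    exact: qf_adj.
  case/tupleP: v => x v; rewrite [v]tuple0 {v}.
  rewrite (_ : [tuple of _] = [tuple x]); last exact: val_inj.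
  apply: iff_trans (sat_colour e c x) (iff_trans _ (iff_sym (sat_colour e' c x))).
  exact: qf_colour.
- by rewrite (IHf _ _ ee') (IHg _ _ ee').
- by rewrite (IHf _ _ ee') (IHg _ _ ee').
- by rewrite (IHf _ _ ee') (IHg _ _ ee').
- split=> h.
    by move=> b; have [a ab] := forth _ e e' b ee'; apply/(IHf _ _ ab).
  by move=> a; have [b ab] := back _ e e' a ee'; apply/(IHf _ _ ab).
- split=> -[].
    by move=> a; have [b ab] := back _ e e' a ee' => /(IHf _ _ ab); exists b.
  by move=> b; have [a ab] := forth _ e e' b ee' => /(IHf _ _ ab); exists a.
Qed.

End QfType.

(** * The free generic extension of a multipartite graph *)

Section Tower.
Variables (n : nat) (M : structure (cg_language n)).

(** A vertex [Witness k t d x P] of colour [k] is meant to be adjacent to those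
    [x i] with [P i].  The stamp [t] prevents a new vertex from being attached
    unintentionally to older ones: a vertex prescribes edges only to vertices
    of a smaller stamp, so that a witness stamped later than a finite family
    has no edges to it but those that it prescribes itself. *)
Inductive tower : Type :=
| Base of M
| Witness (k : 'I_n) (t : nat) (d : nat) (x : 'I_d -> tower) (P : pred 'I_d).

Definition tower_colour (c : 'I_n) (a : tower) : Prop :=
  match a with Base m => colour c m | Witness k _ _ _ _ => c = k end.

Definition stamp (a : tower) : nat :=
  match a with Base _ => 0 | Witness _ t _ _ _ => t end.

Definition prescribes (a b : tower) : Prop :=
  match a with
  | Base _ => False
  | Witness _ t d x P => stamp b < t /\ exists i : 'I_d, x i = b /\ P i
  end.

Definition tower_adj (a b : tower) : Prop :=
  match a, b with
  | Base m, Base m' => adj m m'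
  | _, _ => (prescribes a b \/ prescribes b a) /\
            ~ exists c, tower_colour c a /\ tower_colour c b
  end.

Definition tower_interp (r : cg_symbol n) :
    (@arity (cg_language n) r).-tuple tower -> Prop :=
  match r return (@arity (cg_language n) r).-tuple tower -> Prop with
  | Edge => fun v => tower_adj (tnth v ord0) (tnth v ord_max)
  | Colour c => fun v => tower_colour c (tnth v ord0)
  end.

Lemma tower_nonempty : inhabited tower.
Proof. by have [m] := carrier_nonempty M; exact: (inhabits (Base m)). Qed.

Definition tower_structure : structure (cg_language n) :=
  @Structure (cg_language n) tower tower_interp tower_nonempty.

Lemma tower_embedding : embedding (Base : M -> tower_structure).
Proof. by apply: embeddingP => // x y []. Qed.

Hypothesis MG : partite_graph M.

Lemma tower_partite : partite_graph tower_structure.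
Proof.
have cov (a : tower) : exists c, tower_colour c a.
  by case: a => [m|k *]; [exact: (colour_cover MG m) | exists k].
split.
- move=> a; change (~ tower_adj a a) => aa.
  have [c ca] := cov a.
  case: a aa ca => [m /(adj_irrefl MG)//|k t d x P [_ h] ca].
  by apply: h; exists c.
- move=> a b; change (tower_adj a b -> tower_adj b a).
  have H : (prescribes a b \/ prescribes b a) /\
           ~ (exists c, tower_colour c a /\ tower_colour c b) ->
           (prescribes b a \/ prescribes a b) /\
           ~ (exists c, tower_colour c b /\ tower_colour c a).
    case=> h nc; split; first by case: h; [right|left].
    by case=> c [cb ca]; apply: nc; exists c.
  by case: a H => [m|k t d x P]; case: b => [m'|k' t' d' x' P'] H;
    [exact: (adj_sym MG) | exact: H..].
- exact: cov.
- case=> [m|k t d x P] c d'; first exact: (colour_inj MG).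
  by change (c = k -> d' = k -> c = d') => -> ->.
- move=> a b c; change (tower_adj a b -> tower_colour c a -> ~ tower_colour c b).
  by case: a => [m|k t d x P]; case: b => [m'|k' t' d' x' P'];
    [exact: (adj_colour MG) | move=> [_ nc] ca cb; apply: nc; exists c..].
Qed.

Lemma tower_generic : generic tower_structure.
Proof.
move=> k I x P xP.
pose t := (\max_(i : I) stamp (x i)).+1.
pose y : tower := Witness k t (x \o (@enum_val _ _)) (P \o (@enum_val I predT)).
exists y; split; first by [].
move=> i; change (~ tower_colour k (x i) -> tower_adj (x i) y <-> P i) => ki.
have xt : stamp (x i) < t by rewrite ltnS; exact: leq_bigmax.
have H : ((prescribes (x i) y \/ prescribes y (x i)) /\
          ~ (exists c, tower_colour c (x i) /\ tower_colour c y)) <-> P i.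
  split=> [[[h|[_ [j [xj Pj]]]] _]|Pi].
  - case: (x i) h xt => [//|k' t' d' x' P'] [/= h _] h'.
    by have := ltn_trans h h'; rewrite ltnn.
  - by rewrite -(xP _ _ xj).
  - split; last by case=> c [ci cy]; apply: ki; rewrite -[k]cy.
    right; split=> //; exists (enum_rank i).
    by rewrite /= enum_rankK.
by case: (x i) H.
Qed.

End Tower.

(** * Thinning sequences of finite families *)

Section Thinning.

(** Infinite sets of naturals, in the form which pigeonhole and greedy choices
    use. *)
Definition unbounded (S : nat -> Prop) : Prop := forall N, exists u, N <= u /\ S u.

Lemma unbounded_pigeonhole (T : finType) (S : nat -> Prop) (f : nat -> T) :
  unbounded S -> exists t, unbounded (fun u => S u /\ f u = t).
Proof.
move=> Su; apply: contrapT => no.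
have bnd t : exists N, forall u, N <= u -> S u -> f u <> t.
  apply: contrapT => nb; apply: no; exists t => N.
  apply: contrapT => nu; apply: nb; exists N => u Nu Su' fu.
  by apply: nu; exists u.
have [N hN] := choice bnd.
have [u [uN Su']] := Su (\max_t N t).
apply: (hN (f u) u) => //; exact: leq_trans (leq_bigmax _) uN.
Qed.

(** Either some value of [g u i] recurs unboundedly, and restricting to it
    makes the coordinate [i] constant, or every value is eventually avoided.
    Both alternatives persist in smaller sets, so the coordinates can be
    treated one after the other. *)
Lemma unbounded_dichotomy (T : Type) (I : finType) (S : nat -> Prop)
    (g : nat -> I -> T) : unbounded S ->
  exists S' : nat -> Prop, [/\ unbounded S', forall u, S' u -> S u &
    forall i, (exists c, forall u, S' u -> g u i = c) \/
              (forall c, exists N, forall u, N <= u -> S' u -> g u i <> c)].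
Proof.
move=> Su.
suff : exists S' : nat -> Prop, [/\ unbounded S', forall u, S' u -> S u &
    forall i, i \in enum I -> (exists c, forall u, S' u -> g u i = c) \/
              (forall c, exists N, forall u, N <= u -> S' u -> g u i <> c)].
  case=> S' [Su' SS' h]; exists S'; split=> // i; apply: h.
  by rewrite mem_enum.
elim: (enum I) => [|i s [S' [Su' SS' h]]]; first by exists S; split.
have [[c cu]|nc] := pselect (exists c, unbounded (fun u => S' u /\ g u i = c)).
  exists (fun u => S' u /\ g u i = c); split=> //.
    by move=> u [/SS'].
  move=> j; rewrite inE => /orP[/eqP->|/h[[d hd]|hd]].
  - by left; exists c => u [].
  - by left; exists d => u [/hd].
  - right=> d; have [N hN] := hd d; exists N => u Nu [/(hN _ Nu)].
    by [].
exists S'; split=> // j; rewrite inE => /orP[/eqP->|/h//].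
right=> c; apply: contrapT => nb; apply: nc; exists c => N.
apply: contrapT => nu; apply: nb; exists N => u Nu Su'' gu.
by apply: nu; exists u.
Qed.

Lemma bound_all (I : finType) (Q : I -> nat -> Prop) :
  (forall i, exists N, forall u, N <= u -> Q i u) ->
  exists N, forall u, N <= u -> forall i, Q i u.
Proof.
move=> h; have [N hN] := choice h; exists (\max_i N i) => u Nu i.
by apply: hN; exact: leq_trans (leq_bigmax _) Nu.
Qed.

Definition coherent (T : Type) (U I : Type) (g : U -> I -> T) : Prop :=
  forall u v i j, g u i = g v j -> g u i = g u j.

(** Greedy choice: far enough in the sequence, the coordinates that are not
    constant avoid the finitely many values already used, so that a value
    shared with an earlier family sits at a constant coordinate. *)
Lemma unbounded_coherent (T : Type) (I : finType) (S : nat -> Prop)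
    (g : nat -> I -> T) k : unbounded S ->
  (forall u v i j, S u -> S v -> g u i = g u j -> g v i = g v j) ->
  exists r : 'I_k -> nat, [/\ injective r, forall a, S (r a) & coherent (g \o r)].
Proof.
move=> /(@unbounded_dichotomy _ _ _ g)[S' [Su' SS' di]] eqS.
suff : exists r : 'I_k -> nat,
    [/\ injective r, forall a, S' (r a) & coherent (g \o r)].
  by case=> r [rinj rS' rc]; exists r; split=> // a; exact: SS'.
elim: k => [|k [r [rinj rS' rc]]].
  have r0 : 'I_0 -> nat by case.
  by exists r0; split; case.
have [N1 rN1] : exists N, forall u, N <= u -> forall a, r a < u.
  by apply: bound_all => a; exists (r a).+1.
have [N2 gN2] : exists N, forall u, N <= u -> forall t : I * ('I_k * I),
    (exists c, forall w, S' w -> g w t.1 = c) \/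
    (S' u -> g u t.1 <> g (r t.2.1) t.2.2).
  apply: bound_all => -[i [a j]] /=.
  have [ci|ci] := di i; first by exists 0 => u _; left.
  by have [N hN] := ci (g (r a) j); exists N => u Nu; right; exact: hN.
have [u [+ Su]] := Su' (maxn N1 N2); rewrite geq_max => /andP[Nu1 Nu2].
have const a i j : g u i = g (r a) j -> g u i = g (r a) i.
  have [[c cE] _|h /(h Su)//] := gN2 u Nu2 (i, (a, j)).
  by rewrite !cE.
exists (fun a => oapp r u (unlift ord0 a)); split.
- move=> a b; case: unliftP => [a'|] ->; case: unliftP => [b'|] -> //=.
  + by move/rinj ->.
  + by move=> e; have := rN1 u Nu1 a'; rewrite e ltnn.
  + by move=> e; have := rN1 u Nu1 b'; rewrite -e ltnn.
- by move=> a; case: unliftP => [b|] _ /=.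
- move=> a b i j /=; case: unliftP => [a'|] _; case: unliftP => [b'|] _ //=.
  + exact: (rc a' b').
  + by move=> e; rewrite e; apply: const; exact: esym e.
  + move=> e; apply: (eqS (r b')); rewrite -?(const b' i j e) -?e; auto.
Qed.

End Thinning.

(** * Simplicity *)

Section Elementary.
Variables (L : language).

Lemma elementary_embeddingW (M N : structure L) (h : M -> N) :
  elementary_embedding h -> embedding h.
Proof.
move=> hE; split=> [x y hxy|r v].
  have := (hE _ (FEq (ord0 : 'I_2) ord_max) [tuple x; y]).2.
  by rewrite /= !(tnth_nth x) /= => /(_ hxy).
have := hE _ (FRel r (ord_tuple (arity r))) v.
have ordE (T : Type) k (w : k.-tuple T) : map_tuple (tnth w) (ord_tuple k) = w.
  by apply: val_inj; rewrite /= map_tnth_enum.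
by rewrite /= !ordE.
Qed.

Lemma elementary_model (T : theory L) (M N : structure L) (h : M -> N) :
  elementary_embedding h -> is_model T M -> is_model T N.
Proof.
move=> hE MT f fT; have := (hE _ f [tuple]).1 (MT f fT).
by rewrite [map_tuple _ _]tuple0.
Qed.

Lemma id_embedding (M : structure L) : embedding (@id M).
Proof.
split=> // r v; rewrite (_ : map_tuple id v = v) //.
by apply: val_inj; rewrite /= map_id.
Qed.

End Elementary.

Section Simple.
Variables (n : nat) (n_gt1 : 2 <= n).

(** The quantifier-free type as an element of a finite type, so that the
    pigeonhole principle applies. *)
Definition qf_code (M : structure (cg_language n)) (I : finType) (x : I -> M) :
    {ffun I * I -> bool * bool} * {ffun 'I_n * I -> bool} :=
  ([ffun t => (`[< x t.1 = x t.2 >], `[< adj (x t.1) (x t.2) >])],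
   [ffun t => `[< colour t.1 (x t.2) >]]).

Lemma qf_codeP (M : structure (cg_language n)) (I : finType) (x y : I -> M) :
  qf_code x = qf_code y -> same_qf x y.
Proof.
case=> /ffunP e /ffunP c; split=> [i j|i j|d i].
- by have := e (i, j); rewrite !ffunE => -[h _]; exact: asbool_eq_equiv h.
- by have := e (i, j); rewrite !ffunE => -[_ h]; exact: asbool_eq_equiv h.
- by have := c (d, i); rewrite !ffunE => h; exact: asbool_eq_equiv h.
Qed.

(** Including [F] in the families as constant coordinates makes the conclusion
    hold over [F]: the selected tuples meet [F] at the same places, with the
    same edges. *)
Lemma thin_children (M : structure (cg_language n)) (K : finType) q
    (F : K -> M) (a : nat -> q.-tuple M) k :
  exists r : 'I_k -> nat, injective r /\
    (forall u v, same_qf (case_sum F (tnth (a (r u)))) (case_sum F (tnth (a (r v))))) /\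
    coherent (fun u => case_sum F (tnth (a (r u)))).
Proof.
pose g u := case_sum F (tnth (a u)).
have uT : unbounded (fun _ => True) by move=> N; exists N.
have [c Sc] := unbounded_pigeonhole (fun u => qf_code (g u)) uT.
have [|r [rinj rS rc]] := unbounded_coherent (g := g) k Sc.
  move=> u v i j [_ uc] [_ vc].
  by have /qf_codeP/qf_eq -> : qf_code (g u) = qf_code (g v) by rewrite uc vc.
exists r; split=> //; split=> // u v.
by apply: qf_codeP; rewrite (rS u).2 (rS v).2.
Qed.

(** If a realisation [b] of the formula at the first selected child met that
    child only in [F], the families would be views for which all the
    coordinates of [b] can be copied simultaneously, and the other [k]
    children would be consistent. *)
Lemma new_element (M : structure (cg_language n)) p q
    (f : formula (cg_language n) (p + q)) k (K : finType) (F : K -> M)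
    (a : nat -> q.-tuple M) :
  is_model (Tgcg n) M -> k_inconsistent f k a ->
  exists i, forall (N : structure (cg_language n)) (h : M -> N) (b : p.-tuple N),
    elementary_embedding h -> sat f (cat_tuple b (map_tuple h (a i))) ->
    exists j l, tnth b j = h (tnth (a i) l) /\ forall kap, tnth (a i) l <> F kap.
Proof.
move=> MT inc.
(* One more family than [k]: the first is the child to be followed, and the
   remaining ones contradict [k]-inconsistency. *)
have [r [rinj [rqf rc]]] := thin_children F a k.+1.
exists (r ord0) => N h b hE fb; apply: contrapT => no.
have hm := elementary_embeddingW hE.
have [MG MX] := (Tgcg_modelP M).1 MT.
have [NG NX] := (Tgcg_modelP N).1 (elementary_model hE MT).
pose g u := case_sum F (tnth (a (r u))).
have vz : views (fun u => h \o g u) (h \o g ord0).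
  split=> [u|u w i j /(proj1 hm) /rc]; last first.
    by move/(qf_eq (rqf u ord0)) => e; congr (h _).
  apply: same_qf_trans (embedding_same_qf _ hm).
  by apply: same_qf_sym; apply: same_qf_trans (embedding_same_qf _ hm); exact: rqf.
have hb j : (exists i, tnth b j = (h \o g ord0) i /\
                 forall u w, (h \o g u) i = (h \o g w) i) \/
            (forall i, tnth b j <> (h \o g ord0) i).
  have [[kap bk]|nF] := pselect (exists kap, tnth b j = h (F kap)).
    by left; exists (inl kap).
  right=> -[kap|l] e; first by apply: nF; exists kap.
  apply: no; exists j, l; split=> // kap lk; apply: nF; exists kap.
  by rewrite -lk.
have [b' [b'qf _]] := views_extends ord0 n_gt1 NG NX NG vz hb.
apply: (inc [seq r (lift ord0 u) | u <- enum 'I_k]).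
- by rewrite map_inj_uniq ?enum_uniq // => u v /rinj /lift_inj.
- by rewrite size_map size_enum_ord.
exists N, h; split=> //; exists [tuple b' j | j < p] => _ [i /mapP[u _ ->] <-].
apply: ((sat_same_qf n_gt1 NG NX NG NX f _).2 fb).
set v := lift ord0 u.
pose re (i : 'I_(p + q)) : 'I_p + (K + 'I_q) :=
  match split i with inl j => inl j | inr l => inr (inr l) end.
apply: same_qf_ext (same_qf_reindex re (b'qf v)) => i'; rewrite /re /=.
  by case: split_ordP => j -> /=; rewrite ?tnth_lshift ?tnth_rshift ?tnth_mktuple ?tnth_map.
by case: split_ordP => j -> /=; rewrite ?tnth_lshift ?tnth_rshift ?tnth_map.
Qed.

Lemma Tgcg_simple : simple_theory (Tgcg n).
Proof.
move=> p q f [k [M [a [MT inc con]]]].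
pose F (s : seq nat) (t : 'I_(size s) * 'I_q) : M := tnth (a (take t.1.+1 s)) t.2.
have [i hi] := choice (fun s => new_element (F s) MT (inc s)).
pose path m := iter m (fun s => rcons s (i s)) [::].
have pathE m : mkseq (i \o path) m = path m.
  by elim: m => // m IHm; rewrite mkseqS IHm.
have size_path m : size (path m) = m by rewrite -pathE size_mkseq.
have take_path m m' : m <= m' -> take m (path m') = path m.
  by move=> mm'; rewrite -!pathE -map_take take_iota (minn_idPl mm').
have [N [h [hE [b hb]]]] := con (i \o path).
have hbm m : exists jl : 'I_p * 'I_q, tnth b jl.1 = h (tnth (a (path m.+1)) jl.2) /\
    forall kap, tnth (a (path m.+1)) jl.2 <> F (path m) kap.
  have [|j [l [bl lF]]] := hi (path m) N h b hE; last by exists (j, l).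
  by apply: hb; exists m => //; rewrite pathE.
have [jl hjl] := choice hbm.
(* Already [p + 1] levels are too many for the [p] coordinates of [b]. *)
have /injectivePn[m1 [m2 m12 e12]] : ~~ injectiveb (fun m : 'I_p.+1 => (jl m).1).
  apply/injectiveP => /leq_card; rewrite !card_ord ltnn //.
wlog lt12 : m1 m2 m12 e12 / m1 < m2.
  move=> wl; case: (ltngtP m1 m2) => [|lt21|/val_inj eq12]; first exact: wl.
    by apply: (wl m2 m1) => //; rewrite eq_sym.
  by rewrite eq12 eqxx in m12.
have [b1 _] := hjl m1; have [b2 nF2] := hjl m2.
have m1s : m1 < size (path m2) by rewrite size_path.
apply: (nF2 (Ordinal m1s, (jl m1).2)); rewrite /F /= take_path //.
by apply: (elementary_embeddingW hE).1; rewrite -b1 -b2 e12.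
Qed.

End Simple.

(** * Model companion, completeness and IP *)

Lemma Tgcg_model_exists n (M : structure (cg_language n)) : is_model (Tcg n) M ->
  exists N : structure (cg_language n), is_model (Tgcg n) N /\
    exists h : M -> N, embedding h.
Proof.
move=> /Tcg_modelP MG; exists (tower_structure M); split.
  apply/Tgcg_modelP; split; [exact: tower_partite | exact: tower_generic].
by exists (Base (M := M)); exact: tower_embedding.
Qed.

Lemma Tcg_consistent n : 0 < n ->
  exists M : structure (cg_language n), is_model (Tcg n) M.
Proof.
case: n => // n _.
pose I (r : cg_symbol n.+1) : (@arity (cg_language n.+1) r).-tuple unit -> Prop :=
  match r with Edge => fun _ => False | Colour c => fun _ => c = ord0 end.
exists (@Structure (cg_language n.+1) unit I (inhabits tt)).
apply/Tcg_modelP; split.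
- by move=> x [].
- by move=> x y [].
- by move=> x; exists ord0.
- by move=> x c d; change (c = ord0 -> d = ord0 -> c = d) => -> ->.
- by move=> x y c [].
Qed.

Lemma finite_family (T : Type) (B : set T) : finite_set B ->
  exists m (a : 'I_m -> T), forall x, B x <-> exists i, a i = x.
Proof.
move=> /(@finite_seqP {classic T})[s ->].
exists (size s), (tnth (in_tuple s)) => x; split=> [xs|[i <-]].
  by have /tnthP[i ->] : x \in in_tuple s by []; exists i.
exact: mem_tnth.
Qed.

Section Properties.
Variables (n : nat) (n_gt1 : 2 <= n).

Lemma Tgcg_model_complete : model_complete (Tgcg n).
Proof.
move=> M N /Tgcg_modelP[MG MX] /Tgcg_modelP[NG NX] h hm k f e.
apply: (sat_same_qf n_gt1 MG MX NG NX).
apply: same_qf_ext (embedding_same_qf (tnth e) hm) => // i /=.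
by rewrite tnth_map.
Qed.

Lemma Tgcg_model_companion : model_companion (Tgcg n) (Tcg n).
Proof.
split; last exact: Tgcg_model_complete.
  by move=> M; exact: Tgcg_model_exists.
move=> M /Tgcg_modelP[MG _]; exists M; split; first exact/Tcg_modelP.
by exists id; exact: id_embedding.
Qed.

Lemma Tgcg_complete : complete_theory (Tgcg n).
Proof.
split.
  have [M /Tgcg_model_exists[N [NT _]]] := Tcg_consistent (ltnW n_gt1).
  by exists N.
move=> f; have [fT|nf] := pselect (entails (Tgcg n) f); first by left.
right=> N /Tgcg_modelP[NG NX] Nf; apply: nf => M /Tgcg_modelP[MG MX].
apply: ((sat_same_qf n_gt1 MG MX NG NX f _).2 Nf).
by split=> [[]|[]|c []].
Qed.

Lemma Tgcg_IP : has_IP (Tgcg n).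
Proof.
have [M0 /Tgcg_model_exists[M [MT _]]] := Tcg_consistent (ltnW n_gt1).
have [MG MX] := (Tgcg_modelP M).1 MT.
pose k : 'I_n := Ordinal (ltnW n_gt1).
have [l lk] := other_colour n_gt1 k.
have satE (x a : 1.-tuple M) :
    sat (R_ n (ord0 : 'I_(1 + 1)) ord_max) (cat_tuple x a) <-> adj (thead x) (thead a).
  case/tupleP: x => x v; case/tupleP: a => a w; rewrite [v]tuple0.
  exact: (sat_adj (cat_tuple [tuple of x :: [tuple]] [tuple of a :: w]) ord0 ord_max).
exists 1, 1, (R_ n ord0 ord_max), M, [set a | colour k (thead a)]; split=> //.
  move=> /finite_family[m [a aP]].
  have [y [ky ya]] := colour_avoid n_gt1 MG MX k (fun i => thead (a i)).
  by have [i ai] := (aP [tuple y]).1 ky; apply: (ya i); rewrite ai.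
move=> B J /finite_family[m [a aP]] BA JB.
have [|y [ly hy]] := MX l _ (fun i => thead (a i)) (fun i => `[< J (a i) >]).
  move=> i j aij; congr `[< J _ >]; move: (a i) (a j) aij => b b'.
  case/tupleP: b => x v; case/tupleP: b' => x' w.
  by rewrite !theadE [v]tuple0 [w]tuple0 => ->.
have hB b : B b -> (adj y (thead b) <-> J b).
  move=> Bb; have [i ai] := (aP b).1 Bb.
  have nl : ~ colour l (thead (a i)).
    move=> la; move/eqP: lk; apply; apply: (colour_inj MG la).
    by rewrite ai; exact: BA.
  have := hy i nl; rewrite ai => h.
  split=> [/(adj_sym MG)/h/asboolP//|Jb].
  by apply: (adj_sym MG); apply/h/asboolP.
exists [tuple y]; split=> [b Jb|b [Bb nJ]].
  by apply/satE; rewrite theadE; apply/(hB b (JB b Jb)).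
by move=> /satE; rewrite theadE => /(hB b Bb).
Qed.

End Properties.

Theorem theorem1p1 (n : nat) (hn : 2 <= n) :
  model_companion (Tgcg n) (Tcg n) /\
  complete_theory (Tgcg n) /\ simple_theory (Tgcg n) /\ has_IP (Tgcg n).
Proof.
split; first exact: Tgcg_model_companion.
split; first exact: Tgcg_complete.
by split; [exact: Tgcg_simple | exact: Tgcg_IP].
Qed.
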